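(* Let $Y_1,Y_2,\dots$ be a sequence of continua of span $0$. Then the product $\prod_{i=1}^\infty Y_i$ has the proximate fixed point property.
   Context: A compactum is a compact metrizable space (with a chosen metric $\rho$); a continuum is a connected compactum; a mapping is a continuous function. A (not necessarily continuous) function $f:X\to Y$ between compacta is $\delta$-continuous if there is $\eta>0$ such that $\rho(x,x')<\eta$ implies $\rho(f(x),f(x'))<\delta$. A compactum $X$ has the proximate fixed point property if for every $\varepsilon>0$ there is $\delta>0$ such that for every $\delta$-continuous function $f:X\to X$ there is a point $x\in X$ with $\rho(x,f(x))\le\varepsilon$ (this is a topological property, independent of the metric). A continuum $Y$ is of span $0$, written $\sigma(Y)=0$, if for every continuum $K$ and all mappings $f,g:K\to Y$ with $f(K)=g(K)$ there exists $k\in K$ with $f(k)=g(k)$. *)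

(* Defs.v *)
From mathcomp Require Import all_boot all_order all_algebra.
From mathcomp Require Import all_classical all_reals.
From mathcomp Require Import topology_theory.topology.

Set Implicit Arguments.
Unset Strict Implicit.
Unset Printing Implicit Defensive.

Import Order.TTheory GRing.Theory Num.Theory.

Local Open Scope classical_set_scope.
Local Open Scope ring_scope.

Definition homeomorphism (X Y : topologicalType) (h : X -> Y) : Prop :=
  continuous h /\
  exists2 g : Y -> X, continuous g & cancel h g /\ cancel g h.

Definition metrizable (R : realType) (X : topologicalType) : Prop :=
  exists (M : metricType R) (h : M -> X), homeomorphism h.

Definition compactum (R : realType) (X : topologicalType) : Prop :=
  compact [set: X] /\ metrizable R X.

(* Continua are nonempty by convention; this has to be said explicitly because
   the empty set satisfies [connected]. *)
Definition continuum (R : realType) (X : topologicalType) : Prop :=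
  [/\ compactum R X, connected [set: X] & [set: X] !=set0].

Definition span0 (R : realType) (Y : topologicalType) : Prop :=
  forall (K : topologicalType) (f g : K -> Y), continuum R K ->
    continuous f -> continuous g -> range f = range g ->
    exists k : K, f k = g k.

(* [f] is an arbitrary function, not assumed to be continuous. *)
Definition delta_continuous (R : realType) (X Y : metricType R) (delta : R)
    (f : X -> Y) : Prop :=
  exists2 eta : R, 0 < eta &
    forall x x' : X, mdist x x' < eta -> mdist (f x) (f x') < delta.

Definition metric_proximate_fpp (R : realType) (M : metricType R) : Prop :=
  forall eps : R, 0 < eps -> exists2 delta : R, 0 < delta &
    forall f : M -> M, delta_continuous delta f ->
      exists x : M, mdist x (f x) <= eps.

(* A metric on [X] inducing its topology is presented as a homeomorphism from a
   metric space onto [X]; the property is required for every such metric, and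
   [compactum] guarantees that there is at least one. *)
Definition proximate_fpp (R : realType) (X : topologicalType) : Prop :=
  compactum R X /\
  forall (M : metricType R) (h : M -> X), homeomorphism h ->
    metric_proximate_fpp M.

(* Main.v *)
Require Import Defs.
From HB Require Import structures.
From mathcomp Require Import all_boot all_order all_algebra.
From mathcomp Require Import unstable all_classical all_reals.
From mathcomp Require Import topology_theory.topology.
From mathcomp Require Import zify lra.

Set Implicit Arguments.
Unset Strict Implicit.
Unset Printing Implicit Defensive.

Import Order.TTheory GRing.Theory Num.Theory.

Local Open Scope classical_set_scope.
Local Open Scope ring_scope.

(** Why the theorem is true.

    The heart of the matter is a property of one continuum [T] of span zero:
    every continuum [Z] in [T * T] whose second projection is contained in its
    first one meets the diagonal ([zero_semispan]).  Span zero gives this only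
    when the two projections are equal; the strengthening is a theorem of
    Davis.  It is proved from two observations.  A continuum off the diagonal
    cannot contain both [(a, b)] and [(b, a)], since its union with its mirror
    image would be a continuum with equal projections ([off_diagonal_asym]).
    And it is easy to enlarge a continuum off the diagonal: a product of a
    point with a continuum that avoids the point can be attached as soon as it
    meets the given set.  So take a minimal counterexample [Z], with second
    projection [M], and a component [Q] of the part of [Z] above [M] whose
    first projection is maximal.  By minimality of [Z] some [d] belongs to the
    second projection of [Q] but not to the first; another component [Q'] has
    [d] in its first projection.  By maximality some [c] in the first
    projection of [Q] is missing in that of [Q'].  Boundary bumping then yields
    a continuum in [Z] that joins a point above [d] to a point above some [a]
    outside [M] without passing above [c], and a chain of three attached
    slices produces a continuum off the diagonal that contains both [(a, c)]
    and [(c, a)] ([component_image_grows]).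

    By compactness the conclusion survives discretization: if a chain of small
    steps in [T * T] keeps the two coordinates at distance at least [k], then
    its first coordinate misses a ball whose radius does not depend on the
    chain ([zero_span_semispan_gap]).

    An approximate fixed point in the product is an approximate coincidence in
    finitely many coordinates [i < n].  Choose in each factor a fine walk that
    comes close to all points; the products of these walks form a grid in an
    [n]-dimensional box.  If there were no approximate fixed point, then at
    every grid point some coordinate [i] would be moved by at least [k].  The
    grid points so coloured by [i] fall into chains of small step, each of
    which avoids a ball and hence never crosses some hyperplane of the grid,
    so it lies on one side of it.  Recording the side separates the lower face
    from the upper face of the box in each direction, and no grid point lies
    on all these separators, contrary to the Steinhaus chessboard theorem, the
    [n]-dimensional form of the theorem on the game of Hex ([hex]).  That
    theorem is proved with coefficients modulo 2: the cup product of the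
    coboundaries of the separating functions takes the value 1 on the
    triangulated box, by Stokes and induction on the dimension.

    A map that is only continuous up to [delta] poses no difficulty, because
    the grid can be taken finer than the scale at which [delta] is attained. *)

(** * Chain components *)

(** Connectedness in the form used below: a condition that is locally constant
    along [C] and holds somewhere on [C] holds on all of [C]. *)
Lemma connected_clopen_sub (T : topologicalType) (C B : set T) :
  connected C -> C `&` B !=set0 ->
  (forall x, C x -> B x -> \forall y \near x, C y -> B y) ->
  (forall x, C x -> ~ B x -> \forall y \near x, C y -> ~ B y) ->
  C `<=` B.
Proof.
move=> cC CB Bo Bc; suff <- : C `&` B = C by move=> ? [].
apply: cC => //.
- exists (interior [set y | C y -> B y]); first exact: open_interior.
  apply/seteqP; split=> x [Cx h]; split=> //; first exact: Bo.
  exact: (nbhs_singleton h).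
- exists (~` interior [set y | C y -> ~ B y]).
    exact/open_closedC/open_interior.
  apply/seteqP; split=> x [Cx h]; split=> //.
    by move=> /nbhs_singleton; apply.
  by apply: contrapT => nB; apply: h; exact: Bc.
Qed.

Section ChainClasses.
Variables (R : realType) (S : pseudoMetricType R).
Implicit Types (K F : set S) (d e : R) (x y z w : S).

(** Connectedness of compact sets is handled through finite chains, because
    the same chains occur in the discretized form of the theorem. *)
Inductive chain K d z : S -> Prop :=
| chain_refl : K z -> chain K d z z
| chain_step w w' : chain K d z w -> K w' -> ball w d w' -> chain K d z w'.

(** For a closed subset [K] of a compact space and [z] in [K], this is the
    connected component of [z] in [K]. *)
Definition chain_component K z :=
  \bigcap_(d in [set d : R | 0 < d]) chain K d z.

Lemma chain_sub K d z : chain K d z `<=` K.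
Proof. by move=> w []. Qed.

Lemma chain_start K d z w : chain K d z w -> K z.
Proof. by elim. Qed.

Lemma chain_le K d e z : d <= e -> chain K d z `<=` chain K e z.
Proof.
move=> de w; elim=> [Kz|u v _ zu Kv uv]; first exact: chain_refl.
exact: (chain_step zu Kv (le_ball de uv)).
Qed.

Lemma chain_trans K d z w y :
  chain K d z w -> chain K d w y -> chain K d z y.
Proof. by move=> zw; elim=> // u v _ zu Kv uv; exact: (chain_step zu). Qed.

Lemma chain_sym K d z w : chain K d z w -> chain K d w z.
Proof.
elim=> [Kz|u v zu uz Kv uv]; first exact: chain_refl.
apply: chain_trans uz; apply: chain_step (chain_refl _ Kv) _ (ball_sym uv).
exact: chain_sub zu.
Qed.

Lemma chain_near K d z x : 0 < d -> chain K d z x ->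
  \forall y \near x, K y -> chain K d z y.
Proof.
move=> d0 zx; near=> y => Ky; apply: (chain_step zx Ky).
by near: y; exact: nbhsx_ballx.
Unshelve. all: by end_near. Qed.

Lemma notchain_near K d z x : 0 < d -> K x -> ~ chain K d z x ->
  \forall y \near x, ~ chain K d z y.
Proof.
move=> d0 Kx zx; near=> y => zy; apply: zx; apply: (chain_step zy Kx).
by apply: ball_sym; near: y; exact: nbhsx_ballx.
Unshelve. all: by end_near. Qed.

Lemma chain_closed K d z : closed K -> 0 < d -> closed (chain K d z).
Proof.
move=> cK d0 x cx; have Kx : K x.
  by apply: cK => B /cx[y [/chain_sub Ky By]]; exists y.
have [y [zy xy]] := cx _ (nbhsx_ballx x _ d0).
exact: (chain_step zy Kx (ball_sym xy)).
Qed.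

Lemma chain_component_closed K z : closed K -> closed (chain_component K z).
Proof. by move=> cK; apply: closed_bigI => d d0; exact: chain_closed. Qed.

Lemma chain_component_sub K z : chain_component K z `<=` K.
Proof. by move=> w /(_ 1 ltr01); exact: chain_sub. Qed.

Lemma chain_component_refl K z : K z -> chain_component K z z.
Proof. by move=> Kz d _; exact: chain_refl. Qed.

Lemma chain_component_chain K d z w : 0 < d -> chain K d z w ->
  chain_component K w `<=` chain K d z.
Proof. by move=> d0 zw y /(_ d d0); exact: chain_trans. Qed.

Lemma connected_sub_chain_component K C z :
  connected C -> C `<=` K -> C z -> C `<=` chain_component K z.
Proof.
move=> cC CK Cz w Cw d d0; move: w Cw; apply: connected_clopen_sub => //.
- by exists z; split => //; apply/chain_refl/CK.
- by move=> x Cx /(chain_near d0); apply: filterS => y + /CK; apply.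
- by move=> x /CK Kx /(notchain_near d0 Kx); apply: filterS => y + _; apply.
Qed.

Lemma compact_separation K F : compact K -> closed F -> K `&` F = set0 ->
  exists2 r, 0 < r & forall x y, K x -> F y -> ~ ball x r y.
Proof.
move=> cK cF KF.
have : \forall r \near 0^'+, K `<=` [set x | forall y, F y -> ~ ball x r y].
  apply: (compact_near_coveringP K).1 => // x Kx.
  have Fx : ~ F x by move=> Fx; suff: (set0 : set S) x by []; rewrite -KF.
  have /nbhs_ballP[e /= e0 eF] : nbhs x (~` F).
    by apply: open_nbhs_nbhs; split => //; exact: closed_openC.
  exists (ball x (e / 2), [set r | r < e / 2]) => /=.
    by split; [apply: nbhsx_ballx|apply: nbhs_right_lt]; rewrite divr_gt0.
  move=> [x' r]/= [xx' re] y Fy x'y; apply: (eF y) => //.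
  by apply: (ball_split xx'); exact: le_ball (ltW re) _ x'y.
move=> H; near (0:R)^'+ => r; exists r; first by near: r; exact: nbhs_right_gt.
by move=> x y Kx; have := near H r; apply.
Unshelve. all: by end_near. Qed.

Hypothesis cS : compact [set: S].

Lemma closed_compact K : closed K -> compact K.
Proof. by move=> cK; apply: subclosed_compact cK cS _. Qed.

(** The chain classes decrease to the chain component, so by compactness a
    closed set that avoids the component already avoids one of them. *)
Lemma chain_component_avoid K F z :
  closed K -> closed F -> chain_component K z `&` F = set0 ->
  exists2 d, 0 < d & forall w, chain K d z w -> ~ F w.
Proof.
move=> cK cF zF.
have : \forall d \near 0^'+,
    K `&` F `<=` [set w | ~ chain K d z w].
  apply: (compact_near_coveringP _).1.
    by apply: closed_compact; exact: closedI.
  move=> x [Kx Fx]; have [e e0 zx] : exists2 e, 0 < e & ~ chain K e z x.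
    apply: contrapT => h; suff: (set0 : set S) x by [].
    rewrite -zF; split=> // d d0; apply: contrapT => zx; apply: h.
    by exists d.
  exists ([set y | ~ chain K e z y], [set r | r <= e]) => /=.
    by split; [exact: notchain_near|exact: nbhs_right_le].
  by move=> [x' r]/= [zx' re] /(chain_le re).
move=> H; near (0:R)^'+ => d; exists d => [|w zw Fw].
  by near: d; exact: nbhs_right_gt.
have zK := chain_sub zw.
by have /(_ _ w) := near H d; apply.
Unshelve. all: by end_near. Qed.

(** Points of [A] and [B] are at distance at least [r].  A chain of step at most
    [r / 3] that stays within [r / 3] of the union of [A] and [B] cannot jump
    from the vicinity of [A] to that of [B]. *)
Let chain_component_connected_aux K A B z : closed K -> closed A -> closed B ->
  A `&` B = set0 -> chain_component K z `<=` A `|` B -> A z ->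
  chain_component K z `<=` A.
Proof.
move=> cK cA cB AB QAB Az.
have [r r0 sep] := compact_separation (closed_compact cA) cB AB.
have r30 : 0 < r / 3 by rewrite divr_gt0.
pose N := \bigcup_(a in A `|` B) interior (ball a (r / 3)).
have [||d d0 dN] := @chain_component_avoid K (~` N) z cK.
- apply: open_closedC; apply: bigcup_open => a _; exact: open_interior.
- apply/seteqP; split=> // w [/QAB ABw]; apply; exists w => //.
  exact: nbhsx_ballx.
pose e := Order.min d (r / 3).
have e0 : 0 < e by rewrite lt_min d0.
have inv w : chain K e z w -> exists2 a, A a & ball a (r / 3) w.
  elim=> [_|u v zu [a Aa au] Kv uv]; first by exists z => //; exact: ballxx.
  have : N v.
    apply: contrapT; apply: dN; apply: chain_le (chain_step zu Kv uv).
    by rewrite ge_min lexx.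
  move=> [b ABb /nbhs_singleton bv]; exists b => //; case: ABb => // Bb.
  exfalso; apply: (sep a b Aa Bb).
  rewrite (_ : r = r / 3 + r / 3 + r / 3); last by lra.
  apply: ball_triangle (ball_sym bv); apply: ball_triangle au _.
  by apply: le_ball uv; rewrite ge_min lexx orbT.
move=> w Qw; have [//|Bw] := QAB _ Qw.
have [a Aa aw] := inv _ (Qw e e0); exfalso; apply: (sep a w) => //.
by apply: le_ball aw; rewrite ler_pdivrMr// ler_peMr// ?ltW//; lra.
Qed.

Lemma chain_component_connected K z :
  closed K -> connected (chain_component K z).
Proof.
move=> cK B [b Bb] [O oO BO] [D cD BD].
have Qb : chain_component K z b by move: Bb; rewrite BO => -[].
have cQ := chain_component_closed (z := z) cK.
have Qz : chain_component K z z.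
  by apply: chain_component_refl; exact: chain_start (Qb 1 ltr01).
pose B' := chain_component K z `&` ~` O.
have cB : closed B by rewrite BD; exact: closedI.
have cB' : closed B' by apply: closedI => //; exact: open_closedC.
have BB' : B `&` B' = set0.
  by apply/seteqP; split=> // x [+ [_]]; rewrite BO => -[].
have QBB' : chain_component K z `<=` B `|` B'.
  move=> x Qx; have [Ox|nOx] := pselect (O x); last by right.
  by left; rewrite BO.
have [Bz|B'z] := QBB' _ Qz; apply/seteqP; split; try by rewrite BO => ? [].
  exact: (chain_component_connected_aux cK cB cB').
exfalso; suff : (set0 : set S) b by [].
rewrite -BB'; split=> //; move: b {Bb} Qb.
by apply: (chain_component_connected_aux cK cB' cB) => //;
  rewrite (setIC, setUC)// setUC.
Qed.

(** Boundary bumping.  If the component stayed away from [closure G], so would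
    a chain class of small step; that class would then be open and closed in
    the connected set [Z]. *)
Lemma boundary_bumping Z G z : closed Z -> connected Z -> open G ->
  Z `&` G !=set0 -> Z z -> ~ G z ->
  chain_component (Z `&` ~` G) z `&` closure G !=set0.
Proof.
move=> cZ coZ oG [g [Zg Gg]] Zz nGz; apply/set0P/eqP => h.
have cK : closed (Z `&` ~` G) by apply: closedI => //; exact: open_closedC.
have [|d d0 dG] := chain_component_avoid cK _ h; first exact: closed_closure.
have /(_ g Zg)/dG : Z `<=` chain (Z `&` ~` G) d z.
  apply: connected_clopen_sub => //.
  - by exists z; split=> //; exact: chain_refl.
  - move=> x Zx zx; have nGx : \forall y \near x, ~ closure G y.
      apply: open_nbhs_nbhs; split; last exact: dG.
      exact/closed_openC/closed_closure.
    apply: filterS (filterI nGx (chain_near d0 zx)) => y [nGy + Zy].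
    by apply; split=> // Gy; apply: nGy; exact: subset_closure.
  - move=> x Zx zx; have [Gx|nGx] := pselect (G x).
      apply: filterS (open_nbhs_nbhs (conj oG Gx)) => y Gy _.
      by move=> /chain_sub[].
    by have := notchain_near d0 (conj Zx nGx) zx; apply: filterS => y + _.
by apply; exact: subset_closure.
Qed.

End ChainClasses.

(** * Minimal continua *)

Section Nested.
Variable T : topologicalType.
Implicit Types (A C : set T) (F : set (set T)).
Hypothesis cT : compact [set: T].

Lemma bigcap_total_meet F C : F !=set0 -> total_on F subset ->
  (forall A, F A -> closed A) -> closed C ->
  (forall A, F A -> A `&` C !=set0) -> \bigcap_(A in F) A `&` C !=set0.
Proof.
move=> F0 totF clF clC FC.
pose G := filter_from F (fun A => A `&` C).
have GF : ProperFilter G.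
  apply: filter_from_proper => //; apply: filter_from_filter => //.
  move=> A B FA FB; have [AB|BA] := totF A B FA FB.
    by exists A => // x [Ax Cx]; split; split => //; exact: AB.
  by exists B => // x [Bx Cx]; split; split => //; exact: BA.
have [p [_ clp]] := cT GF filterT; exists p; split.
  move=> A FA; apply: (clF A FA) => U Up.
  have GA : G (A `&` C) by exists A.
  by have [y [[Ay _] Uy]] := clp _ _ GA Up; exists y.
apply: clC => U Up; have [A FA] := F0; have GA : G (A `&` C) by exists A.
by have [y [[_ Cy] Uy]] := clp _ _ GA Up; exists y.
Qed.

(** Zorn's lemma for decreasing families, obtained from its form for increasing
    unions by passing to complements in [Z0]. *)
Lemma exists_minimal (P : set (set T)) Z0 : P Z0 ->
  (forall F, F !=set0 -> F `<=` P -> total_on F subset ->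
    P (\bigcap_(A in F) A)) ->
  exists Z, [/\ P Z, Z `<=` Z0 & forall Z', P Z' -> Z' `<=` Z -> Z' = Z].
Proof.
move=> PZ0 Pcap.
have [|A [PA maxA]] := @Zorn_bigcup T [set A | P (Z0 `\` A)].
  move=> F FP totF; have [F0|F0] := pselect (F !=set0); last first.
    suff -> : \bigcup_(X in F) X = set0 by rewrite /= setD0.
    by apply/seteqP; split => // x [X FX _]; apply: F0; exists X.
  rewrite /=; suff -> : Z0 `\` \bigcup_(X in F) X
      = \bigcap_(B in [set Z0 `\` X | X in F]) B.
    apply: Pcap.
    - by have [X FX] := F0; exists (Z0 `\` X); exists X.
    - by move=> _ [X FX <-]; exact: FP.
    - move=> _ _ [X FX <-] [Y FY <-].
      by have [XY|YX] := totF X Y FX FY; [right|left]; exact: setDS.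
  apply/seteqP; split=> x.
    by move=> [Zx nFx] _ [X FX <-]; split=> // Xx; apply: nFx; exists X.
  move=> h; have [X FX] := F0; split.
    by have [] : (Z0 `\` X) x by apply: h; exists X.
  by move=> [Y FY Yx]; have [] : (Z0 `\` Y) x by apply: h; exists Y.
exists (Z0 `\` A); split => // Z' PZ' Z'Z; apply: contrapT => neq.
have [z [[Zz nAz] nZ'z]] : exists z, (Z0 `\` A) z /\ ~ Z' z.
  apply: contrapT => h; apply: neq; apply/seteqP; split => // z Zz.
  by apply: contrapT => nz; apply: h; exists z.
apply: (maxA (~` Z')).
  split; first by move=> x Ax /Z'Z[].
  by move=> /(_ z nZ'z).
rewrite /= setDE setCK (_ : Z0 `&` Z' = Z')//.
by apply/setIidPr => x /Z'Z[].
Qed.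

End Nested.

(** Some member of the nested family is close to the intersection, so chains in
    that member can be pushed into the intersection. *)
Lemma bigcap_total_connected (R : realType) (S : pseudoMetricType R)
    (F : set (set S)) : compact [set: S] -> F !=set0 -> total_on F subset ->
  (forall A, F A -> closed A) -> (forall A, F A -> connected A) ->
  connected (\bigcap_(A in F) A).
Proof.
move=> cS F0 totF clF coF; set K := \bigcap_(A in F) A.
have cK : closed K by exact: closed_bigI.
have [->|/set0P[z Kz]] := eqVneq K set0; first exact: connected0.
suff -> : K = chain_component K z by exact: chain_component_connected.
apply/seteqP; split; last exact: chain_component_sub.
move=> w Kw d d0; have d30 : 0 < d / 3 by rewrite divr_gt0.
pose N := \bigcup_(k in K) interior (ball k (d / 3)).
have [A FA AN] : exists2 A, F A & A `<=` N.
  apply: contrapT => h.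
  have [||x [Kx]] := @bigcap_total_meet S cS F (~` N) F0 totF clF.
  - by apply: open_closedC; apply: bigcup_open => k _; exact: open_interior.
  - move=> A FA; apply/set0P/eqP => AN; apply: h; exists A => // x Ax.
    by apply: contrapT => nNx; suff : (set0 : set S) x by []; rewrite -AN.
  - by apply; exists x => //; exact: nbhsx_ballx.
have : chain A (d / 3) z w.
  have Aw : A w by exact: Kw.
  apply: (connected_sub_chain_component (coF A FA) _ _ Aw) => //; exact: Kz.
suff inv v : chain A (d / 3) z v ->
    exists2 k, chain K d z k & ball k (d / 3) v.
  move=> /inv[k zk kw]; apply: (chain_step zk Kw).
  by apply: le_ball kw; lra.
elim=> [_|u v' _ [k zk ku] /AN[k' Kk' /nbhs_singleton k'v] uv].
  by exists z; [exact: chain_refl|exact: ballxx].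
exists k' => //; apply: (chain_step zk Kk').
rewrite (_ : d = d / 3 + d / 3 + d / 3); last by lra.
by apply: ball_triangle (ball_sym k'v); exact: ball_triangle ku uv.
Qed.

(** * Zero span implies zero semispan *)

Lemma continuous_image_connected (X X' : topologicalType) (f : X -> X')
    (A : set X) :
  continuous f -> connected A -> connected (f @` A).
Proof.
move=> cf cA; apply: connected_continuous_connected => //.
exact: continuous_subspaceT.
Qed.

Definition subcontinuum (X : topologicalType) (Z : set X) :=
  [/\ closed Z, connected Z & Z !=set0].

Lemma subcontinuumU (X : topologicalType) (Z U : set X) :
  subcontinuum Z -> subcontinuum U ->
  Z `&` U !=set0 -> subcontinuum (Z `|` U).
Proof.
move=> [cZ coZ [z Zz]] [cU coU _] ZU; split; last by exists z; left.
- exact: closedU.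
- exact: connectedU.
Qed.

(** Span zero for a space in its own right: a pair of maps from a continuum only
    matters through the image of the pair in the square. *)
Definition set_span0 (X : topologicalType) := forall Z : set (X * X),
  subcontinuum Z -> fst @` Z = snd @` Z -> exists2 z, Z z & z.1 = z.2.

Section Span.
Variables (R : realType) (T : metricType R).
Implicit Types (Z U : set (T * T)) (M : set T) (a b c : T).

Definition off_diagonal Z := forall z, Z z -> z.1 <> z.2.

Lemma fst_cont : continuous (@fst T T).
Proof. by move=> x; exact: cvg_fst. Qed.

Lemma snd_cont : continuous (@snd T T).
Proof. by move=> x; exact: cvg_snd. Qed.

Lemma closed_point a : closed [set a].
Proof. exact/accessible_closed_set1/hausdorff_accessible/metric_hausdorff. Qed.

Lemma closed_prod M M' : closed M -> closed M' -> closed (M `*` M').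
Proof.
move=> cM cM'; rewrite (_ : M `*` M' = fst @^-1` M `&` snd @^-1` M')//.
by apply: closedI; apply: preimage_closed => // x _;
  [exact: fst_cont|exact: snd_cont].
Qed.

Lemma subcontinuum_slice a M : subcontinuum M -> subcontinuum ([set a] `*` M).
Proof.
move=> [cM coM [m Mm]]; split; last by exists (a, m).
  by apply: closed_prod => //; exact: closed_point.
rewrite (_ : _ `*` _ = (fun y => (a, y)) @` M).
  apply: continuous_image_connected => // x.
  by apply: cvg_pair => //; exact: cvg_cst.
by apply/seteqP; split=> [[x y] [/= -> My]|_ [y My <-]]//; exists y.
Qed.

Lemma swap_preimage Z : swap @^-1` Z = swap @` Z.
Proof.
by apply/seteqP; split=> [[x y]/= Zyx|_ [[x y] Zxy <-]]//=; exists (y, x).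
Qed.

Lemma subcontinuum_swap Z : subcontinuum Z -> subcontinuum (swap @` Z).
Proof.
move=> [cZ coZ [z Zz]]; split; last by exists (swap z); exists z.
- rewrite -swap_preimage; apply: preimage_closed => // x _.
  exact: swap_continuous.
- by apply: continuous_image_connected => //; exact: swap_continuous.
Qed.

Hypothesis cT : compact [set: T].

Lemma compactTT : compact [set: T * T].
Proof. by rewrite -setXTT; exact: compact_setX. Qed.

Lemma subcontinuum_image (f : T * T -> T) Z : continuous f ->
  subcontinuum Z -> subcontinuum (f @` Z).
Proof.
move=> cf [cZ coZ [z Zz]]; split; last by exists (f z); exists z.
- apply: compact_closed; first exact: metric_hausdorff.
  apply: continuous_compact; first exact: continuous_subspaceT.
  by apply: (@closed_compact R) cZ; exact: compactTT.
- exact: continuous_image_connected.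
Qed.

Hypothesis span0T : set_span0 T.

(** Otherwise [U] and its mirror image intersect, and their union is a continuum
    off the diagonal with equal projections. *)
Lemma off_diagonal_asym U a b : subcontinuum U -> off_diagonal U ->
  U (a, b) -> ~ U (b, a).
Proof.
move=> scU offU Uab Uba.
have scV : subcontinuum (U `|` swap @` U).
  apply: subcontinuumU => //; first exact: subcontinuum_swap.
  by exists (a, b); split => //; exists (b, a).
have [|z [Uz|[y Uy <-]]] := span0T scV; last 2 first.
- exact: offU.
- by move=> /esym; exact: offU.
apply/seteqP; split=> _ [z [Uz|[y Uy <-]] <-].
- by exists (swap z) => //; right; exists z.
- by exists y => //; left.
- by exists (swap z) => //; right; exists z.
- by exists y => //; left.
Qed.

Section Minimal.
Variable Z : set (T * T).
Hypotheses (scZ : subcontinuum Z) (offZ : off_diagonal Z).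
Hypothesis sub : snd @` Z `<=` fst @` Z.
Let M := snd @` Z.
Let F := Z `&` fst @^-1` M.

Let closedF : closed F.
Proof.
have [cZ _ _] := scZ; apply: closedI => //; apply: preimage_closed.
  by move=> x _; exact: fst_cont.
by have [] := subcontinuum_image snd_cont scZ.
Qed.

Let scQ z : F z -> subcontinuum (chain_component F z).
Proof.
move=> Fz; split; [exact: chain_component_closed| |].
  by apply: chain_component_connected => //; exact: compactTT.
by exists z; exact: chain_component_refl.
Qed.

(** Let [d] be the first coordinate of [z'], and suppose that [c] belongs to the
    first projection [fst Q] of the component of [z] but not to that of the
    component of [z'].  Boundary bumping gives a continuum [C] through [z'] that
    approaches the fibre over [c] without meeting it.  Since the component of
    [z'] in [F] stays away from that fibre, [C] leaves [F], hence contains a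
    point over some [a] outside [M].  The slices over [a], at height [d] and
    over [c] now connect [(a, c)], [Z], [(c, d)] and [(c, a)] in this order. *)
Lemma component_image_grows z z' : F z -> Z z' ->
  (snd @` chain_component F z) z'.1 -> ~ (fst @` chain_component F z) z'.1 ->
  fst @` chain_component F z `<=` fst @` chain_component F z'.
Proof.
move=> Fz Zz' Qd nQd c Qc; apply: contrapT => nc.
pose d := z'.1; pose Q := chain_component F z; pose Q' := chain_component F z'.
have [cZ coZ _] := scZ.
have Md : M d by have [y /chain_component_sub[Zy _] yd] := Qd; exists y.
have Fz' : F z' by split.
have [cQ' _ _] := subcontinuum_image fst_cont (scQ Fz').
have [r r0 rc] : exists2 r, 0 < r & forall x, ball c r x -> ~ (fst @` Q') x.
  have /nbhs_ballP[r /= r0 rc] : nbhs c (~` (fst @` Q')).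
    by apply: open_nbhs_nbhs; split => //; exact: closed_openC.
  by exists r.
pose G : set (T * T) := fst @^-1` interior (ball c (r / 2)).
have cG : interior (ball c (r / 2)) c.
  by apply: nbhsx_ballx; rewrite divr_gt0.
have oG : open G.
  by apply: open_comp => [x _|]; [exact: fst_cont|exact: open_interior].
(* The ball of radius [r / 2] leaves room for the closure of [G] to avoid the
   first projection of [Q'] as well. *)
have Gr x : closure G x -> ball c r x.1.
  move=> /(_ _ (nbhsx_ballx x (r / 2) _))[|y [/nbhs_singleton cy [xy _]]].
    by rewrite divr_gt0.
  by apply: ball_split cy _; exact: ball_sym.
have nGz' : ~ G z'.
  move=> /(@subset_closure _ G)/Gr/rc; apply; exists z' => //.
  exact: chain_component_refl.
have ZG : Z `&` G !=set0.
  have [y /chain_component_sub[Zy _] yc] := Qc.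
  by exists y; split=> //; rewrite /G/= yc.
have [w [Cw Gw]] := boundary_bumping compactTT cZ coZ oG ZG Zz' nGz'.
set C := chain_component _ z' in Cw.
have cK : closed (Z `&` ~` G) by apply: closedI => //; exact: open_closedC.
have scC : subcontinuum C.
  split; [exact: chain_component_closed| |].
    exact: chain_component_connected compactTT _ _ cK.
  by exists w.
have CK : C `<=` Z `&` ~` G by exact: chain_component_sub.
have Cz' : C z' by apply: chain_component_refl.
have [a [y Cy ya] nMa] : exists2 a, (fst @` C) a & ~ M a.
  apply: contrapT => h.
  have CF : C `<=` F.
    move=> y Cy; split; first by have [] := CK _ Cy.
    by apply: contrapT => nMy; apply: h; exists y.1 => //; exists y.
  have [_ coC _] := scC.
  have Q'w := connected_sub_chain_component coC CF Cz' Cw.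
  by apply: (rc w.1 (Gr _ Gw)); exists w.
have ncC : ~ (fst @` C) c.
  by move=> [x /CK[_ nGx] xc]; apply: nGx; rewrite /G/= xc.
have Mc : M c by have [x /chain_component_sub[_ Mx] <-] := Qc.
have [x Qx xd] := Qd.
have scM := subcontinuum_image snd_cont scZ.
pose U1 := Z `|` [set a] `*` M.
pose U2 := swap @` ([set d] `*` (fst @` Q)).
pose U3 := [set c] `*` (fst @` C).
have sc1 : subcontinuum U1.
  apply: subcontinuumU => //; first exact: subcontinuum_slice.
  have [Zy _] := CK _ Cy.
  by exists y; split=> //; split=> //=; exists y.
have sc2 : subcontinuum (U1 `|` U2).
  apply: subcontinuumU => //.
    apply: subcontinuum_swap; apply: subcontinuum_slice.
    exact: subcontinuum_image fst_cont (scQ Fz).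
  exists x; split; first by left; have [] := chain_component_sub Qx.
  exists (d, x.1); first by split => //; exists x.
  by rewrite /swap/= /d -xd; case: (x).
have sc3 : subcontinuum (U1 `|` U2 `|` U3).
  apply: subcontinuumU => //.
    by apply: subcontinuum_slice; exact: subcontinuum_image fst_cont scC.
  exists (c, d); split; first by right; exists (d, c).
  by split => //=; exists z'.
have off : off_diagonal (U1 `|` U2 `|` U3).
  move=> u [[[Zu|[ua Mu]]|[v [vd Qv] <-]]|[uc Cu]] eq12; first exact: offZ eq12.
  - by apply: nMa; rewrite -ua eq12.
  - by apply: nQd; rewrite -[z'.1]vd -[v.1]eq12.
  - by apply: ncC; rewrite -uc eq12.
apply: (off_diagonal_asym sc3 off (a := a) (b := c)).
- by left; left; right.
- by right; split => //=; exists y.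
Qed.

Hypothesis minZ : forall Z', subcontinuum Z' -> snd @` Z' `<=` fst @` Z' ->
  Z' `<=` Z -> Z' = Z.

(** A component [Q] of [F] with maximal first projection is one that
    [component_image_grows] cannot enlarge.  It exists because components vary
    upper semicontinuously: along a chain of growing projections, a limit of
    points chosen in the components lies in a component whose projection
    contains all of them. *)
Lemma no_minimal_counterexample : False.
Proof.
have [cZ coZ [z0 Zz0]] := scZ.
have sQ z : F z ->
    ~ (snd @` chain_component F z `<=` fst @` chain_component F z).
  move=> Fz QQ; have QZ : chain_component F z = Z.
    by apply: minZ => //; [exact: scQ|move=> y /chain_component_sub[]].
  have [|y Zy] := span0T scZ; last by move/(offZ Zy).
  apply/seteqP; split=> // _ [y Zy <-].
  have : chain_component F z y by rewrite QZ.
  by move=> /chain_component_sub[].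
(* Subsets of the projections are used, rather than the projections
   themselves, so that the family is closed under unions of chains. *)
have [|A [[z Fz AQ] maxA]] :=
    @Zorn_bigcup T [set A | exists2 z, F z & A `<=` fst @` chain_component F z].
  move=> FF FFP totF.
  have [FF0|FF0] := pselect (FF !=set0); last first.
    have [y Zy yz0] : (fst @` Z) z0.2 by apply: sub; exists z0.
    exists y; first by split=> //; exists z0.
    by move=> x [X FX _]; exfalso; apply: FF0; exists X.
  pose G A := F `&` [set z | A `<=` fst @` chain_component F z].
  pose GG := filter_from FF G.
  have GF : ProperFilter GG.
    apply: filter_from_proper; last first.
      by move=> A /FFP[z Fz Az]; exists z.
    apply: filter_from_filter => // A B FA FB.
    have [AB|BA] := totF A B FA FB.
      by exists B => // z [Fz Bz]; split; split => //; exact: subset_trans Bz.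
    by exists A => // z [Fz Az]; split; split => //; exact: subset_trans Az.
  have [z [_ clz]] := compactTT GF filterT.
  have Fz : F z.
    apply: closedF => U Uz; have [A FA] := FF0.
    have GA : GG (G A) by exists A.
    by have [y [[Fy _] Uy]] := clz _ _ GA Uz; exists y.
  exists z => // e [A FA Ae]; apply: contrapT => nQe.
  have [||d d0 avoid] := chain_component_avoid compactTT
    (F := fst @^-1` [set e]) (z := z) closedF.
  - apply: preimage_closed; first by move=> x _; exact: fst_cont.
    exact: closed_point.
  - by apply/seteqP; split=> // x [Qx xe]; apply: nQe; exists x.
  have GA : GG (G A) by exists A.
  have [y [[Fy Ay] zy]] := clz _ _ GA (nbhsx_ballx z d d0).
  have [x Qx xe] := Ay _ Ae; apply: avoid xe.
  apply: (chain_component_chain d0 _ Qx).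
  by apply: chain_step (chain_refl _ Fz) Fy zy.
have [d [Qd nQd]] : exists d,
    (snd @` chain_component F z) d /\ ~ (fst @` chain_component F z) d.
  apply: contrapT => h; apply: (sQ z Fz) => d Qd; apply: contrapT => nd.
  by apply: h; exists d.
have [z' Zz' z'd] : (fst @` Z) d.
  by apply: sub; have [y /chain_component_sub[Zy _] <-] := Qd; exists y.
rewrite -z'd in Qd nQd.
have Fz' : F z'.
  by split => //; have [y /chain_component_sub[Zy _] yd] := Qd; exists y.
apply: (maxA (fst @` chain_component F z')); last by exists z'.
have grow := component_image_grows Fz Zz' Qd nQd.
split; first exact: subset_trans grow.
move=> subA; apply: nQd; apply: AQ; apply: subA.
by exists z' => //; exact: chain_component_refl.
Qed.
End Minimal.

(** Semispan zero.  The inclusion of the projections passes to intersections of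
    nested continua, so a counterexample would contain a minimal one. *)
Theorem zero_semispan Z : subcontinuum Z -> snd @` Z `<=` fst @` Z ->
  exists2 z, Z z & z.1 = z.2.
Proof.
move=> scZ sub; apply: contrapT => h.
have offZ : off_diagonal Z by move=> z Zz e; apply: h; exists z.
have [||Y [[scY subY] YZ minY]] := @exists_minimal (T * T)%type
    [set Y | subcontinuum Y /\ snd @` Y `<=` fst @` Y] Z.
- by split.
- move=> FF FF0 FFP totF.
  have clF A : FF A -> closed A by move=> /FFP[[]].
  split; first split.
  + exact: closed_bigI.
  + apply: bigcap_total_connected => //; first exact: compactTT.
    by move=> A /FFP[[]].
  + have [|z [Fz _]] := bigcap_total_meet compactTT FF0 totF clF closedT.
      by move=> A /FFP[[_ _ A0] _]; rewrite setIT.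
    by exists z.
  + move=> _ [z Fz <-].
    have [||y [Fy yz]] := bigcap_total_meet compactTT FF0 totF clF
        (C := fst @^-1` [set z.2]).
    * apply: preimage_closed; first by move=> x _; exact: fst_cont.
      exact: closed_point.
    * move=> A FA; have [_ subA] := FFP A FA.
      have [|y Ay yz] := subA z.2; first by exists z => //; exact: Fz.
      by exists y.
    * by exists y.
apply: (no_minimal_counterexample scY) => //.
  by move=> z /YZ; exact: offZ.
by move=> Z' scZ' subZ' Z'Y; apply: minY.
Qed.
End Span.

(** * Subcontinua of a square as spaces *)

Section MetricInstances.
Variable R : realType.

Section Prod.
Variables (T U : metricType R).

Definition prod_mdist (p q : T * U) : R :=
  Num.max (mdist p.1 q.1) (mdist p.2 q.2).

Let prod_mdist_ge0 p q : 0 <= prod_mdist p q.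
Proof. by rewrite le_max mdist_ge0. Qed.

Let prod_mdist_positivity p q : prod_mdist p q = 0 -> p = q.
Proof.
move=> pq; have : prod_mdist p q <= 0 by rewrite pq.
rewrite ge_max => /andP[pq1 pq2].
rewrite [p]surjective_pairing [q]surjective_pairing; congr (_, _);
  apply: mdist_positivity; apply/eqP; rewrite eq_le mdist_ge0.
  by rewrite pq1.
by rewrite pq2.
Qed.

Let prod_ballE p (d : R) : ball p d = [set q | prod_mdist p q < d].
Proof.
apply/seteqP; split=> q /=; rewrite /prod_mdist gt_max.
  by move=> [] /=; rewrite !ballEmdist => -> ->.
by case/andP => h1 h2; split; rewrite ballEmdist.
Qed.

HB.instance Definition _ := PseudoMetric_isMetric.Build R (T * U)%type
  prod_mdist_ge0 prod_mdist_positivity prod_ballE.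
End Prod.

Section Sub.
Variables (T : metricType R) (A : set T).

Let sub_mdist_ge0 (u v : A) : 0 <= mdist (val u) (val v).
Proof. exact: mdist_ge0. Qed.

Let sub_mdist_positivity (u v : A) : mdist (val u) (val v) = 0 -> u = v.
Proof. by move/mdist_positivity/val_inj. Qed.

Let sub_ballE (u : A) (d : R) : ball u d = [set v | mdist (val u) (val v) < d].
Proof. by rewrite -initial_ballE ballEmdist. Qed.

HB.instance Definition _ := PseudoMetric_isMetric.Build R (set_type A)
  sub_mdist_ge0 sub_mdist_positivity sub_ballE.
End Sub.

End MetricInstances.

Lemma set_type_compact (T : topologicalType) (A : set T) :
  compact A -> compact [set: A].
Proof.
move=> cA F PF _.
have PG : ProperFilter (val @ F) by exact: fmap_proper_filter.
have GA : F [set u | A (val u)] by apply: filterE => u; exact: set_valP.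
have [p [Ap clp]] := cA _ PG GA.
exists (SigSub (mem_set Ap)); split => // B U FB [_ [[O oO <-] Op OU]].
have GB : F [set u | (val @` B) (val u)] by apply: filterS FB => u Bu; exists u.
have [_ [[u Bu <-] Ou]] := clp _ _ GB (open_nbhs_nbhs (conj oO Op)).
by exists u; split => //; exact: OU.
Qed.

Lemma set_type_connected (T : topologicalType) (A : set T) :
  connected A -> connected [set: A].
Proof.
move=> coA B [b Bb] [O oO BO] [D cD BD].
rewrite setTI in BO; rewrite setTI in BD.
have near_sub (V : set A) (u : A) : nbhs u V ->
    \forall y \near val u, forall v : A, val v = y -> V v.
  move=> [_ [[W oW <-] Wu WV]].
  apply: filterS (open_nbhs_nbhs (conj oW Wu)) => y Wy v vy.
  by apply: WV; rewrite /= -[set_val v]/(val v) vy.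
have AB : A `<=` val @` B.
  apply: connected_clopen_sub => //.
  - by exists (val b); split; [exact: set_valP|exists b].
  - move=> _ _ [u Bu <-]; have Bo : nbhs u B.
      by rewrite BO in Bu *; exact: open_nbhs_nbhs.
    apply: filterS (near_sub _ _ Bo) => y + Ay.
    by move=> /(_ (SigSub (mem_set Ay)) erefl) By; exists (SigSub (mem_set Ay)).
  - move=> x Ax nBx; pose u : A := SigSub (mem_set Ax).
    have nBu : nbhs u (~` B).
      apply: open_nbhs_nbhs; split; first by rewrite openC BD.
      by move=> Bu; apply: nBx; exists u.
    by apply: filterS (near_sub _ _ nBu) => y h _ [v Bv vy]; exact: h vy Bv.
by apply/seteqP; split=> // u _; have [v Bv /val_inj <-] := AB _ (set_valP u).
Qed.

(** A subcontinuum of the square, taken as a space of its own, is the domain of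
    the two maps to which the definition of span zero is applied. *)
Lemma span0_coincidence (R : realType) (Y : topologicalType) (T : metricType R)
    (h : T -> Y) : compact [set: T] -> homeomorphism h -> span0 R Y ->
  set_span0 T.
Proof.
move=> cT [ch [g cg [hK gK]]] sY Z [cZ coZ [z Zz]] fs.
have cK : continuum R Z.
  split; last by exists (SigSub (mem_set Zz)).
    split.
      apply: set_type_compact.
      exact: (@closed_compact R) (compactTT cT) _ cZ.
    have cid : continuous (id : Z -> Z) by move=> u; exact: cvg_id.
    by exists Z, id; split => //; exists id.
  exact: set_type_connected.
have cv : continuous (val : Z -> T * T) by exact: initial_continuous.
have [|||k] := sY Z (fun u => h (val u).1) (fun u => h (val u).2) cK.
- move=> u; apply: (@continuous_comp _ _ _ (fun u : Z => (val u).1) h);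
    last exact: ch.
  by apply: continuous_comp; [exact: cv|exact: fst_cont].
- move=> u; apply: (@continuous_comp _ _ _ (fun u : Z => (val u).2) h);
    last exact: ch.
  by apply: continuous_comp; [exact: cv|exact: snd_cont].
- apply/seteqP; split=> _ [u _ <-].
    have : (snd @` Z) (val u).1.
      by rewrite -fs; exists (val u) => //; exact: set_valP.
    by move=> [v Zv vu]; exists (SigSub (mem_set Zv)) => //=; rewrite vu.
  have : (fst @` Z) (val u).2.
    by rewrite fs; exists (val u) => //; exact: set_valP.
  by move=> [v Zv vu]; exists (SigSub (mem_set Zv)) => //=; rewrite vu.
by move=> /(can_inj hK) e; exists (val k) => //; exact: set_valP.
Qed.

(** * Semispan zero for chains *)

Section Discrete.
Variables (R : realType) (T : metricType R).
Hypothesis cT : compact [set: T].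
Hypothesis span0T : set_span0 T.

Definition far (k : R) : set (T * T) := [set z | k <= mdist z.1 z.2].

Lemma far_closed k : closed (far k).
Proof.
move=> p cp; rewrite /far/= leNgt; apply/negP => pk.
pose e := (k - mdist p.1 p.2) / 2.
have e0 : 0 < e by rewrite divr_gt0// subr_gt0.
have [q [fq [p1 p2]]] := cp _ (nbhsx_ballx p e e0).
rewrite ballEmdist/= in p1; rewrite ballEmdist/= in p2.
have t1 := metric_triangle q.1 p.1 q.2; have t2 := metric_triangle p.1 p.2 q.2.
rewrite (metric_sym q.1 p.1) in t1; rewrite /far/= in fq; rewrite /e in p1 p2.
lra.
Qed.

(** The size [d] serves both as the step of the chains and as the radius of the
    ball that their first coordinate avoids; hence the property is inherited by
    all smaller sizes. *)
Definition semispan_gap (k d : R) := forall z, far k z ->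
  exists t : T, forall w, chain (far k) d z w -> ~ ball t d w.1.

(** The chain component of a point of [far k] is a continuum off the diagonal,
    so by [zero_semispan] its first projection leaves out some point, hence a
    ball.
    The same ball is avoided by chains of small step that start near the given
    point, and compactness of [far k] makes the step uniform. *)
Lemma zero_span_semispan_gap k : 0 < k -> exists2 d, 0 < d & semispan_gap k d.
Proof.
move=> k0.
have cTT := compactTT cT.
have : \forall d \near 0^'+, far k `<=` [set z | exists t, forall w,
    chain (far k) d z w -> ~ ball t d w.1].
  apply: (compact_near_coveringP _).1.
    by apply: (@closed_compact R) cTT _ (far_closed (k := k)).
  move=> z Kz; pose Q := chain_component (far k) z.
  have scQ : subcontinuum Q.
    split; [exact/chain_component_closed/far_closed| |].
      exact/chain_component_connected/far_closed.
    by exists z; exact: chain_component_refl.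
  have [t nQt] : exists t, ~ (fst @` Q) t.
    apply: contrapT => h.
    have [|w Qw w12] := zero_semispan cT span0T scQ.
      by move=> t _; apply: contrapT => nt; apply: h; exists t.
    by have := chain_component_sub Qw; rewrite /far/= w12 mdistxx leNgt k0.
  have [cfQ _ _] := subcontinuum_image cT (@fst_cont _ T) scQ.
  have /nbhs_ballP[r /= r0 rQ] : nbhs t (~` (fst @` Q)).
    by apply: open_nbhs_nbhs; split => //; exact: closed_openC.
  have r20 : 0 < r / 2 by rewrite divr_gt0.
  have [||d d0 dF] := chain_component_avoid cTT
      (F := fst @^-1` closure (ball t (r / 2))) (z := z) (far_closed (k := k)).
  - apply: preimage_closed; first by move=> x _; exact: fst_cont.
    exact: closed_closure.
  - apply/seteqP; split=> // x [Qx] /(_ _ (nbhsx_ballx _ _ r20)) [y [ty xy]].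
    by case: (rQ x.1); [exact: ball_split ty (ball_sym xy)|exists x].
  exists (ball z d, [set e | e <= d] `&` [set e | e <= r / 2]) => /=.
    split; first exact: nbhsx_ballx.
    by apply: filterI; exact: nbhs_right_le.
  move=> [z' e]/= [zz' [ed er]]; exists t => w zw tw.
  apply: (dF w); last by apply: subset_closure; exact: le_ball tw.
  apply: chain_trans (chain_le ed zw).
  exact: chain_step (chain_refl _ Kz) (chain_start zw) zz'.
move=> H; near (0:R)^'+ => d; exists d; first by near: d; exact: nbhs_right_gt.
by have := near H d; apply.
Unshelve. all: by end_near. Qed.

End Discrete.

(** * The Steinhaus chessboard theorem *)

Section Prisms.
Local Open Scope nat_scope.
Implicit Types (l q : seq (seq nat)) (v w b : seq nat) (t m : nat).
Implicit Types (c : seq (seq (seq nat))) (ms : seq nat).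

(** A vertex is a list of coordinates, a simplex a list of vertices, and a
    chain with coefficients modulo 2 a list of simplices.  Chains are never
    compared; they are only evaluated against cochains, and [parity om c] is
    the value of the cochain [om] on the chain [c]. *)
Definition parity (om : seq (seq nat) -> bool) c :=
  \big[addb/false]_(l <- c) om l.

Lemma parity_nil om : parity om [::] = false.
Proof. by rewrite /parity big_nil. Qed.

Lemma parity_cons om l c : parity om (l :: c) = om l (+) parity om c.
Proof. by rewrite /parity big_cons. Qed.

Lemma parity_cat om c c' : parity om (c ++ c') = parity om c (+) parity om c'.
Proof. by rewrite /parity big_cat. Qed.

Lemma parity_map om (f : seq (seq nat) -> seq (seq nat)) c :
  parity om (map f c) = parity (om \o f) c.
Proof. by rewrite /parity big_map. Qed.

Lemma parity_flatten om (I : Type) (f : I -> seq (seq (seq nat))) (r : seq I) :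
  parity om (flatten (map f r)) = \big[addb/false]_(i <- r) parity om (f i).
Proof.
elim: r => [|i r IH]; first by rewrite big_nil parity_nil.
by rewrite big_cons /= parity_cat IH.
Qed.

(** The augmented boundary: a single vertex has the empty simplex as boundary,
    which makes the recursion uniform. *)
Fixpoint boundary l : seq (seq (seq nat)) :=
  if l is v :: l' then l' :: map (cons v) (boundary l') else [::].

(** The usual triangulation of the product of a simplex with the interval from
    [t] to [t.+1], the new coordinate being put first. *)
Fixpoint prism t l : seq (seq (seq nat)) :=
  if l is v :: l' then
    ((t :: v) :: map (cons t.+1) l) :: map (cons (t :: v)) (prism t l')
  else [::].

Lemma parity_boundary_cons om v l :
  parity om (boundary (v :: l)) = om l (+) parity (om \o cons v) (boundary l).
Proof. by rewrite /= parity_cons parity_map. Qed.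

Lemma parity_prism_cons om t v l : parity om (prism t (v :: l)) =
  om ((t :: v) :: map (cons t.+1) (v :: l)) (+)
  parity (om \o cons (t :: v)) (prism t l).
Proof. by rewrite /= parity_cons parity_map. Qed.

Lemma eq_parity om om' c : om =1 om' -> parity om c = parity om' c.
Proof. by move=> e; apply: eq_bigr. Qed.

Lemma parity_add om om' c :
  parity (fun l => om l (+) om' l) c = parity om c (+) parity om' c.
Proof. by rewrite /parity big_split. Qed.

Lemma boundary_map (f : seq nat -> seq nat) l :
  boundary (map f l) = map (map f) (boundary l).
Proof.
elim: l => //= v l ->; congr cons; rewrite -!map_comp.
exact: eq_map.
Qed.

(** The prism operator is a chain homotopy between the two ends of the
    interval. *)
Lemma boundary_prism om t l :
  parity (fun q => parity om (boundary q)) (prism t l) =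
  om (map (cons t) l) (+) om (map (cons t.+1) l) (+)
  parity (fun q => parity om (prism t q)) (boundary l).
Proof.
elim: l om => [|v l IH] om; first by rewrite /= !parity_nil addbb.
pose om0 := om \o cons (t :: v).
pose om01 q := om ((t :: v) :: (t.+1 :: v) :: map (cons t.+1) q).
rewrite parity_prism_cons.
have -> : parity om (boundary ((t :: v) :: map (cons t.+1) (v :: l))) =
    om (map (cons t.+1) (v :: l)) (+) (om0 (map (cons t.+1) l) (+)
    parity om01 (boundary l)).
  by rewrite [map _ (v :: l)]/= !parity_boundary_cons boundary_map parity_map.
rewrite (eq_parity (om := (fun q => parity om (boundary q)) \o cons (t :: v))
  (om' := fun q => om q (+) parity om0 (boundary q))); last first.
  by move=> q; rewrite /= parity_cons parity_map.
rewrite parity_add IH parity_boundary_cons.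
rewrite [in RHS](eq_parity (om := (fun q => parity om (prism t q)) \o cons v)
  (om' := fun q => om01 q (+) parity om0 (prism t q))); last first.
  by move=> q /=; rewrite parity_cons parity_map.
rewrite parity_add /= -[om ((t :: v) :: _)]/(om0 (map (cons t) l)).
move: (parity _ _) (parity om _) (parity om01 _) (om0 _)
  (om0 (map (cons t.+1) l)) (om _).
by do 6 case.
Qed.

(** The cup product of the coboundaries of the functions in [phis]: the i-th
    function has to change along the i-th edge of the simplex. *)
Fixpoint cup (phis : seq (seq nat -> bool)) l : bool :=
  match phis, l with
  | [::], [:: _] => true
  | phi :: phis', v :: ((w :: _) as l') => (phi v (+) phi w) && cup phis' l'
  | _, _ => false
  end.

Lemma parity_andl x om c : parity (fun q => x && om q) c = x && parity om c.
Proof. by rewrite /parity big_distrr. Qed.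

Lemma cup_nil phis : cup phis [::] = false.
Proof. by case: phis. Qed.

Lemma addb_eq0 (x y : bool) : x (+) y = false -> y = x.
Proof. by case: x; case: y. Qed.

Lemma cup_closed phis l : parity (cup phis) (boundary l) = false.
Proof.
elim: phis l => [|phi phis IH] [|v [|w l]]; rewrite ?parity_nil //;
  try by rewrite /parity big_seq1.
- rewrite !parity_boundary_cons; case: l => [|u l] /=.
    by rewrite parity_nil.
  by rewrite /parity big1.
- rewrite !parity_boundary_cons [X in _ (+) (_ (+) X)](eq_parity
    (om' := fun q => (phi v (+) phi w) && cup phis (w :: q))) //.
  have := IH (w :: l); rewrite parity_andl parity_boundary_cons => /addb_eq0.
  rewrite -/(cup phis \o cons w) => ->.
  case: l => [|u l] /=; first by rewrite cup_nil andbF.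
  by case: (phi v); case: (phi w); case: (phi u); case: (cup _ _).
Qed.

(** A primitive of [cup (phi :: phis)]: the cup product of the function [phi]
    itself with the coboundaries of the others. *)
Definition cup_head phi phis l :=
  if l is v :: _ then phi v && cup phis l else false.

Lemma cup_stokes phi phis l :
  parity (cup_head phi phis) (boundary l) = cup (phi :: phis) l.
Proof.
case: l => [|v l]; first by rewrite parity_nil.
rewrite parity_boundary_cons (eq_parity (om := _ \o _)
  (om' := fun q => phi v && cup phis (v :: q))) // parity_andl.
have := cup_closed phis (v :: l); rewrite parity_boundary_cons => /addb_eq0.
rewrite -/(cup phis \o cons v) => ->.
case: l => [|w l] /=; first by rewrite cup_nil andbF.
by case: (phi v); case: (phi w); case: (cup _ _).
Qed.

(** The triangulation of the box whose i-th side runs from [0] to the i-th entry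
    of [ms], sliced along its first coordinate. *)
Fixpoint box ms : seq (seq (seq nat)) :=
  if ms is m :: ms' then
    flatten [seq flatten [seq prism t l | l <- box ms'] | t <- iota 0 m]
  else [:: [:: [::]]].

Lemma parity_box om m ms : parity om (box (m :: ms)) =
  \big[addb/false]_(0 <= t < m)
     parity (fun l => parity om (prism t l)) (box ms).
Proof.
rewrite /= parity_flatten /index_iota subn0; apply: eq_bigr => t _.
by rewrite parity_flatten.
Qed.

Lemma addb_telescope (f : nat -> bool) m :
  \big[addb/false]_(0 <= t < m) (f t (+) f t.+1) = f 0 (+) f m.
Proof.
elim: m => [|m IH]; first by rewrite big_nil addbb.
by rewrite big_nat_recr //= IH; case: (f 0); case: (f m); case: (f m.+1).
Qed.

(** The boundary of the box consists of its two faces in the first direction and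
    of the prisms over the boundary of the remaining box; the faces between
    consecutive slices cancel. *)
Lemma parity_boundary_box om m ms :
  parity (fun l => parity om (boundary l)) (box (m :: ms)) =
  parity (fun l => om (map (cons 0) l) (+) om (map (cons m) l)) (box ms) (+)
  \big[addb/false]_(0 <= t < m)
     parity (fun l => parity (fun q => parity om (prism t q)) (boundary l))
       (box ms).
Proof.
rewrite parity_box.
under eq_bigr => t _.
  rewrite (eq_parity (om' := fun l =>
    (om (map (cons t) l) (+) om (map (cons t.+1) l)) (+)
    parity (fun q => parity om (prism t q)) (boundary l))); last first.
    by move=> l; exact: boundary_prism.
  rewrite parity_add.
over.
rewrite big_split /=; congr addb; rewrite /parity exchange_big.
by apply: eq_bigr => l _; rewrite addb_telescope.
Qed.

Definition in_face i t l := all (fun v => nth 0 v i == t) l.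

Lemma prism_vertex t l q u : q \in prism t l -> u \in q ->
  exists t' v, [/\ u = t' :: v, v \in l & t <= t' <= t.+1].
Proof.
elim: l q => [|v l IH] q //=; rewrite inE => /orP[/eqP ->|/mapP[q' q'P ->]].
  rewrite inE => /orP[/eqP ->|].
    by exists t, v; rewrite mem_head leqnn leqnSn.
  rewrite -(map_cons (cons t.+1)) => /mapP[w wl ->].
  by exists t.+1, w; rewrite leqnn leqnSn.
rewrite inE => /orP[/eqP ->|/(IH _ q'P)[t' [w [-> wl tt']]]].
  by exists t, v; rewrite mem_head leqnn leqnSn.
by exists t', w; rewrite inE wl orbT.
Qed.

Lemma in_face_prism i x t l q :
  in_face i x l -> q \in prism t l -> in_face i.+1 x q.
Proof.
elim: l q => [|v l IH] q //= /andP[vx lx]; rewrite inE => /orP[/eqP ->|].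
  by rewrite /= vx /in_face all_map; apply/allP => u /(allP lx).
by move=> /mapP[q' q'P ->]; rewrite /= vx; exact: IH.
Qed.

Lemma parity_eq0 om c :
  (forall l, l \in c -> om l = false) -> parity om c = false.
Proof. by move=> om0; rewrite /parity big_seq big1. Qed.

(** The boundary of the box is carried by its faces.  The empty simplex needs a
    separate hypothesis: it is the boundary of the box of dimension 0. *)
Lemma parity_boundary_box_eq0 om ms : om [::] = false ->
  (forall i l, i < size ms -> in_face i 0 l || in_face i (nth 0 ms i) l ->
     om l = false) ->
  parity (fun l => parity om (boundary l)) (box ms) = false.
Proof.
elim: ms om => [|m ms IH] om om0 omF; first by rewrite /parity !big_seq1.
rewrite parity_boundary_box parity_eq0 => [|l _]; last first.
  by rewrite !(omF 0) //= /in_face !all_map; apply/orP; [right|left];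
    apply/allP => v _ /=.
rewrite big1 // => t _; apply: IH => [|i l im lF]; first by rewrite parity_nil.
apply: parity_eq0 => q ql.
apply: (omF i.+1) => //=.
by case/orP: lF => /in_face_prism/(_ ql) ->; rewrite ?orbT.
Qed.

Lemma cup_face phis i (b : bool) l : i < size phis ->
  (forall v, v \in l -> nth xpredT phis i v = b) -> cup phis l = false.
Proof.
elim: phis i l => [|phi phis IH] [|i] [|v [|w l]] //= isz lb.
  by rewrite (lb v) ?(lb w) ?inE ?eqxx ?orbT // addbb.
by rewrite (IH i) ?andbF // => u ul; apply: lb; rewrite inE ul orbT.
Qed.

Lemma cup_map phis (f : seq nat -> seq nat) l :
  cup phis (map f l) = cup (map (fun phi => phi \o f) phis) l.
Proof. by elim: phis l => [|phi phis IH] [|v [|w l]] //=; rewrite -IH. Qed.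

Definition separates (phi : seq nat -> bool) i m :=
  forall v, (nth 0 v i = 0 -> phi v = false) /\ (nth 0 v i = m -> phi v = true).

(** Induction on the dimension.  By Stokes the value is that of the primitive
    [cup_head] on the boundary.  On a face in a later direction a function of
    [phis] is constant, so its coboundary kills the product; on the lower face
    in the first direction [phi] vanishes, and on the upper one [phi] is 1,
    which leaves the cup product of one function less on that face. *)
Lemma cup_box phis ms : size phis = size ms ->
  (forall i, i < size ms -> separates (nth xpredT phis i) i (nth 0 ms i)) ->
  parity (cup phis) (box ms) = true.
Proof.
elim: ms phis => [|m ms IH] [|phi phis] //; first by rewrite /parity big_seq1.
move=> [sz] sep.
rewrite (eq_parity (om' := fun l => parity (cup_head phi phis) (boundary l)));
  last first.
  by move=> l; rewrite cup_stokes.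
rewrite parity_boundary_box big1 ?addbF => [|t _].
  rewrite (eq_parity (om' := cup (map (fun phi => phi \o cons m) phis))).
    apply: IH; first by rewrite size_map.
    move=> i im v; rewrite (nth_map xpredT) ?sz //=.
    exact: (sep i.+1 im (m :: v)).
  case=> [|v l]; first by rewrite cup_nil.
  have phi0 : phi (0 :: v) = false by exact: (sep 0 isT (0 :: v)).1 erefl.
  have phim : phi (m :: v) = true by exact: (sep 0 isT (m :: v)).2 erefl.
  by rewrite -cup_map /cup_head /= phi0 phim.
apply: parity_boundary_box_eq0 => [|i l im lF]; first by rewrite parity_nil.
have [b lb] : exists b : bool, forall t' v, v \in l ->
    nth xpredT phis i (t' :: v) = b.
  case/orP: lF => /allP lF; [exists false|exists true] => t' v /lF /eqP vi.
    by apply: (sep i.+1 im _).1.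
  by apply: (sep i.+1 im _).2.
apply: parity_eq0 => q ql; rewrite /cup_head; case: q ql => // v q ql.
rewrite (@cup_face _ i b) ?andbF ?sz // => u uq.
by have [t' [w [-> wl _]]] := prism_vertex ql uq; exact: lb.
Qed.

(** Each simplex of the triangulation lies in a unit cube, of which [b] is the
    least corner. *)
Lemma box_vertex ms l : l \in box ms -> exists b, forall v, v \in l ->
  forall i, nth 0 b i <= nth 0 v i <= (nth 0 b i).+1.
Proof.
elim: ms l => [|m ms IH] l /=.
  rewrite inE => /eqP ->; exists [::] => v; rewrite inE => /eqP -> i.
  by rewrite nth_nil.
move=> /flattenP[_ /mapP[t _ ->] /flattenP[_ /mapP[q qb ->] lq]].
have [b bq] := IH q qb; exists (t :: b) => v vl.
by have [t' [w [-> wq tt']]] := prism_vertex lq vl; case=> //= i; exact: bq.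
Qed.

Lemma cup_flips phis l : cup phis l -> forall i, i < size phis ->
  exists v w,
    [/\ v \in l, w \in l & nth xpredT phis i v != nth xpredT phis i w].
Proof.
elim: phis l => [|phi phis IH] [|v [|w l]] //=.
move=> /andP[vw /IH{}IH] [_|i /IH[u [u' [ul ul' uu']]]].
  exists v, w; rewrite !inE !eqxx orbT; split => //=.
  by case: (phi v) (phi w) vw => [] [].
by exists u, u'; split => //; rewrite inE (ul, ul') orbT.
Qed.

(** As the cup product has value 1 on the box, it is nonzero on some simplex,
    along whose edges all the separating functions change: one unit cube meets
    all the separators. *)
Theorem hex ms (phi : nat -> seq nat -> bool) :
  (forall i, i < size ms -> separates (phi i) i (nth 0 ms i)) ->
  exists b, forall i, i < size ms -> exists v w,
    [/\ phi i v != phi i w,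
        forall j, nth 0 b j <= nth 0 v j <= (nth 0 b j).+1 &
        forall j, nth 0 b j <= nth 0 w j <= (nth 0 b j).+1].
Proof.
move=> sep; pose phis := mkseq phi (size ms).
have evT : parity (cup phis) (box ms) = true.
  apply: cup_box; first by rewrite size_mkseq.
  by move=> i im; rewrite nth_mkseq //; exact: sep.
have [/hasP[l lb cl]|/hasPn h] := boolP (has (cup phis) (box ms)); last first.
  by rewrite parity_eq0 // in evT => l /h /negbTE.
have [b bl] := box_vertex lb; exists b => i im.
have [|v [w [vl wl]]] := cup_flips cl (i := i); first by rewrite size_mkseq.
by rewrite nth_mkseq // => vw; exists v, w; split => //; exact: bl.
Qed.

End Prisms.

(** * Fine walks and grids *)

Section Path.
Variables (R : realType) (T : metricType R).
Hypotheses (cT : compact [set: T]) (coT : connected [set: T]) (t0 : T).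

Lemma finite_net (r : R) : 0 < r ->
  exists s : seq T, forall t, exists2 c, c \in s & ball c r t.
Proof.
move=> r0.
pose F : set_system (seq T) :=
  filter_from [set: seq T] (fun s => [set s' : seq T | {subset s <= s'}]).
have FF : Filter F.
  apply: filter_from_filter; first by exists [::].
  move=> s s' _ _; exists (s ++ s') => // u su.
  by split=> c cs; apply: su; rewrite mem_cat cs ?orbT.
have [|s _ /(_ s)] := (compact_near_coveringP _).1 cT (seq T) F
    (fun s t => exists2 c, c \in s & ball c r t) FF.
  move=> t _; exists (ball t r, [set s : seq T | {subset [:: t] <= s}]) => /=.
    by split; [exact: nbhsx_ballx|exists [:: t]].
  by move=> [t' s]/= [tt' st]; exists t => //; apply: st; rewrite mem_head.
by move=> h; exists s => t; apply: h.
Qed.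

(** A walk through the points of a finite net, joined by chains. *)
Lemma dense_path (r : R) : 0 < r -> exists m (x : nat -> T),
  [/\ (0 < m)%N, forall k, ball (x k) r (x k.+1) &
      forall t, exists2 k, (k <= m)%N & ball (x k) r t].
Proof.
move=> r0; have [s snet] := finite_net r0.
pose S (ts : seq T) w := exists m (x : nat -> T),
  [/\ forall k, ball (x k) r (x k.+1), forall k, (m <= k)%N -> x k = w &
      forall c, c \in ts -> exists2 k, (k <= m)%N & x k = c].
have Sstep ts w w' : S ts w -> ball w r w' -> S ts w'.
  move=> [m [x [xr xm xts]]] ww'.
  exists m.+1, (fun k => if (k <= m)%N then x k else w'); split.
  - move=> k; have [km|mk] := ltnP k m; first by rewrite (ltnW km); exact: xr.
    have [->|/eqP km] := eqVneq k m; first by rewrite leqnn xm.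
    by rewrite ifF; [exact: ballxx|lia].
  - by move=> k mk; rewrite ifF//; lia.
  - by move=> c /xts[k km <-]; exists k; [lia|rewrite km].
have Schain ts w w' : S ts w -> S ts w'.
  move=> Sw; have : chain [set: T] r w w'.
    by apply: (connected_sub_chain_component coT).
  by elim=> // u v _ Su _ uv; exact: Sstep uv.
have [w [m [x [xr _ xs]]]] : exists w, S s w.
  elim: s {snet} => [|c s [w Sw]].
    exists t0, 0%N, (fun=> t0); split => // k; exact: ballxx.
  exists c; have [m [x [xr xm xs]]] := Schain _ _ c Sw.
  exists m, x; split => // c'; rewrite inE => /orP[/eqP ->|/xs//].
  by exists m => //; exact: xm.
exists m.+1, x; split => // t; have [c /xs[k km <-] ct] := snet t.
by exists k => //; exact: leqW.
Qed.

Lemma semispan_gap_le k d e :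
  d <= e -> semispan_gap T k e -> semispan_gap T k d.
Proof.
move=> de gap z zk; have [t ht] := gap z zk; exists t => w zw tw.
by apply: ht (chain_le de zw) _; exact: le_ball tw.
Qed.

Lemma path_jump2 (r : R) (x : nat -> T) a b : 0 < r ->
  (forall j, ball (x j) r (x j.+1)) -> (a <= b + 2)%N -> (b <= a + 2)%N ->
  ball (x a) (r + r) (x b).
Proof.
move=> r0 xr; wlog ab : a b / (a <= b)%N => [wlg|_ ba].
  have [ab|ba] := leqP a b; first exact: wlg.
  by move=> ab2 ba2; apply: ball_sym; apply: wlg => //; exact: ltnW.
have [->|[->|->]] : b = a \/ b = a.+1 \/ b = a.+2 by lia.
- by apply: ballxx; rewrite addr_gt0.
- by apply: le_ball (xr a); rewrite lerDl ltW.
- exact: ball_triangle (xr _) (xr _).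
Qed.

(** A walk with step [r] comes close to the centre of the ball that a given
    class of chains avoids; the index [kk] at which it does so depends only on
    the class, and the class stays off the indices next to it.  The margin of
    two steps is what allows neighbours of neighbours in the grid to be
    compared; it accounts for the radius [r * 3], which is two steps and one
    approximation. *)
Lemma excluded_index k d r m (x : nat -> T) : 0 < r -> r * 3 <= d ->
  semispan_gap T k d ->
  (forall j, ball (x j) r (x j.+1)) ->
  (forall t, exists2 j, (j <= m)%N & ball (x j) r t) ->
  exists kk : T * T -> nat,
    (forall z z', chain (far k) d z z' -> kk z = kk z') /\
    (forall z j, far k z -> z.1 = x j ->
      (kk z <= m)%N /\ ((j + 2 < kk z)%N \/ (kk z + 2 < j)%N)).
Proof.
move=> r0 rd gap xr xdense.
pose P (A : set (T * T)) := [set j | (j <= m)%N /\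
  exists2 t, (forall w, A w -> ~ ball t d w.1) & ball (x j) r t].
exists (fun z => xget 0%N (P (chain (far k) d z))); split.
  move=> z z' zz'; congr (xget _ (P _)).
  by apply/seteqP; split=> w; apply: chain_trans; [exact: chain_sym|exact: zz'].
move=> z j kz zj; case: xgetP => [jj _|/(_ _)]; last first.
  have [t ht] := gap z kz; have [jj jjm xt] := xdense t.
  by move=> /(_ jj); case; split => //; exists t.
move=> [jjm [t ht xt]]; split => //.
have nball : ~ ball t d (x j).
  by rewrite -zj; apply: ht; exact: chain_refl.
have [?|?] := boolP ((j + 2 < jj)%N || (jj + 2 < j)%N); first exact/orP.
exfalso; apply: nball; apply: (@le_ball _ _ _ (r + (r + r))); first lra.
by apply: ball_triangle (ball_sym xt) _; apply: path_jump2 => //; lia.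
Qed.

End Path.

Section Grid.
Variables (R : realType) (T : nat -> metricType R).
Hypothesis cT : forall i, compact [set: T i].
Hypothesis coT : forall i, connected [set: T i].
Variable t0 : forall i, T i.
Variables (n : nat) (k : R).
Hypothesis gapT : forall i, exists2 d, 0 < d & semispan_gap (T i) k d.

Lemma common_gap : exists2 d, 0 < d &
  forall i, (i < n)%N -> semispan_gap (T i) k d.
Proof.
elim: n => [|p [d d0 IH]]; first by exists 1.
have [e e0 pe] := gapT p; exists (Order.min d e); first by rewrite lt_min d0.
move=> i; rewrite ltnS leq_eqVlt => /orP[/eqP ->|/IH h].
  by apply: semispan_gap_le pe; rewrite ge_min lexx orbT.
by apply: semispan_gap_le h; rewrite ge_min lexx.
Qed.

(** At a grid point [s] the colour [i] means that [z i s] is far from the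
    diagonal; then [kk i (z i s)] is an index that [s] stays away from in
    direction [i].  The function [phi i] is 1 on the upper face and next to the
    points of colour [i] that lie above their excluded index, so it is constant
    near each point of colour [i].  But [hex] provides a grid point near which
    every [phi i] changes. *)
Theorem approximate_fixed_point : exists2 d, 0 < d &
  forall (g : (forall i, T i) -> forall i, T i) (e : R), 0 < e ->
    (forall x y, (forall i, ball (x i) e (y i)) ->
      forall i, (i < n)%N -> ball (g x i) d (g y i)) ->
    exists x, forall i, (i < n)%N -> mdist (x i) (g x i) < k.
Proof.
have [d d0 gap] := common_gap; exists d => // g e e0 gcont.
pose r := Order.min d e / 3.
have r0 : 0 < r by rewrite divr_gt0// lt_min d0.
have r3 : r * 3 = Order.min d e by rewrite /r divfK// pnatr_eq0.
have rd : r * 3 <= d by rewrite r3 ge_min lexx.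
have re : r * 3 <= e by rewrite r3 ge_min lexx orbT.
have data i : exists D : nat * (nat -> T i) * (T i * T i -> nat),
    [/\ (0 < D.1.1)%N, forall j, ball (D.1.2 j) r (D.1.2 j.+1) &
      (i < n)%N ->
      (forall z z', chain (far k) d z z' -> D.2 z = D.2 z') /\
      (forall z j, far k z -> z.1 = D.1.2 j ->
      (D.2 z <= D.1.1)%N /\ ((j + 2 < D.2 z)%N \/ (D.2 z + 2 < j)%N))].
  have [m [x [m0 xr xd]]] := dense_path (@cT i) (@coT i) (t0 i) r0.
  have [ni|ni] := ltnP i n; last by exists (m, x, fun=> 0%N).
  have [kk hkk] := excluded_index r0 rd (gap i ni) xr xd.
  by exists (m, x, kk).
pose m i := (projT1 (cid (data i))).1.1.
pose x i := (projT1 (cid (data i))).1.2.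
pose kk i := (projT1 (cid (data i))).2.
have m0 i : (0 < m i)%N by rewrite /m; case: cid => D [].
have xr i j : ball (x i j) r (x i j.+1) by rewrite /x; case: cid => D [].
have kkc i z z' : (i < n)%N -> chain (far k) d z z' -> kk i z = kk i z'.
  by rewrite /kk; case: cid => D D' /=; have [_ _ h] := D' => /h[+ _]; apply.
have kkfar i z j : (i < n)%N -> far k z -> z.1 = x i j ->
    (kk i z <= m i)%N /\ ((j + 2 < kk i z)%N \/ (kk i z + 2 < j)%N).
  rewrite /kk /x /m; case: cid => D D' /=.
  by have [_ _ h] := D' => /h[_]; apply.
clearbody m x kk; clear data.
pose p (s : seq nat) : forall i, T i := fun i => x i (nth 0%N s i).
pose z i s := (p s i, g (p s) i).
apply: contrapT => nofix.
have colour s : exists2 i, (i < n)%N & far k (z i s).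
  apply: contrapT => h; apply: nofix; exists (p s) => i ni.
  by rewrite ltNge; apply/negP => kp; apply: h; exists i.
pose adj (s s' : seq nat) :=
  forall j, (nth 0 s j <= (nth 0 s' j).+1)%N /\
            (nth 0 s' j <= (nth 0 s j).+1)%N.
have near2 s u s' : adj s u -> adj u s' ->
    forall i, ball (p s i) (r + r) (p s' i).
  move=> su us' i; have := su i; have := us' i => ? ?.
  by apply: path_jump2 => //; lia.
have same s u s' i : (i < n)%N -> adj s u -> adj u s' -> far k (z i s) ->
    far k (z i s') -> kk i (z i s) = kk i (z i s').
  move=> ni su us' fs fs'; apply: kkc => //.
  apply: chain_step (chain_refl _ fs) fs' _; split => /=.
    by apply: le_ball (near2 _ _ _ su us' i); lra.
  apply: gcont => // j; apply: le_ball (near2 _ _ _ su us' j); lra.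
pose phi i (s : seq nat) := `[< nth 0%N s i = m i \/
  exists u, [/\ adj u s, far k (z i u) & (kk i (z i u) < nth 0 u i)%N] >].
have [i|b hb] := @hex (mkseq m n) phi.
  rewrite size_mkseq => ni s; rewrite nth_mkseq//; split => si; last first.
    by apply/asboolP; left.
  apply/asboolP => -[sm|[u [us fu ku]]]; first by have := m0 i; lia.
  have := us i; have := kkfar i (z i u) (nth 0%N u i) ni fu erefl.
  lia.
have [i ni fb] := colour b.
have := hb i; rewrite size_mkseq => /(_ ni)[v [w [vw bv bw]]].
have key s : (forall j, nth 0 b j <= nth 0 s j <= (nth 0 b j).+1)%N ->
    phi i s = (kk i (z i b) < nth 0 b i)%N.
  move=> bs; have bs' : adj b s by move=> j; have := bs j; lia.
  have kb := kkfar i (z i b) (nth 0%N b i) ni fb erefl.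
  have [lt|ge] := ltnP (kk i (z i b)) (nth 0%N b i).
    by apply/asboolP; right; exists b.
  apply/asboolP => -[sm|[u [us fu ku]]]; first by have := bs i; lia.
  have sb : adj s b by move=> j; have := bs j; lia.
  have e1 := same u s b i ni us sb fu fb.
  have := us i; have := sb i; lia.
by move: vw; rewrite !key // eqxx.
Qed.

End Grid.

(** * The metric of a countable product *)

Section ProductMetric.
Variables (R : realType) (T : nat -> metricType R).

(** A copy of the product type, so that the metric below does not interfere with
    the product topology of the same type. *)
Definition metric_product := forall i, T i.

HB.instance Definition _ := gen_eqMixin metric_product.
HB.instance Definition _ := gen_choiceMixin metric_product.

Definition coord_dist (x y : metric_product) i : R :=
  Num.min (mdist (x i) (y i)) i.+1%:R^-1.

Definition product_dist (x y : metric_product) : R :=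
  sup (range (coord_dist x y)).

Let has_sup_coord x y : has_sup (range (coord_dist x y)).
Proof.
split; first by exists (coord_dist x y 0%N); exists 0%N.
exists 1 => _ [i _ <-]; rewrite ge_min; apply/orP; right.
by rewrite invf_le1 ?ltr0n// ler1n.
Qed.

Lemma coord_dist_le x y i : coord_dist x y i <= product_dist x y.
Proof. by apply: sup_upper_bound; [exact: has_sup_coord|exists i]. Qed.

Lemma product_dist_le x y (e : R) :
  (forall i, coord_dist x y i <= e) -> product_dist x y <= e.
Proof.
move=> h; apply: sup_le_ub; first by exists (coord_dist x y 0%N); exists 0%N.
by move=> _ [i _ <-]; exact: h.
Qed.

Let product_distxx x : product_dist x x = 0.
Proof.
apply/eqP; rewrite eq_le; apply/andP; split.
  by apply: product_dist_le => i; rewrite /coord_dist mdistxx ge_min lexx.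
apply: le_trans (coord_dist_le x x 0%N).
by rewrite /coord_dist mdistxx le_min lexx invr_ge0 ler0n.
Qed.

Let product_dist_positivity x y : product_dist x y = 0 -> x = y.
Proof.
move=> xy; apply: functional_extensionality_dep => i.
apply: mdist_positivity; apply/eqP; rewrite eq_le mdist_ge0 andbT.
have := coord_dist_le x y i; rewrite xy ge_min => /orP[//|].
by rewrite leNgt invr_gt0 ltr0n.
Qed.

Let product_dist_sym x y : product_dist x y = product_dist y x.
Proof.
suff e : coord_dist x y = coord_dist y x by rewrite /product_dist e.
by apply/funext => i; rewrite /coord_dist metric_sym.
Qed.

Let product_dist_triangle y x z :
  product_dist x z <= product_dist x y + product_dist y z.
Proof.
apply: product_dist_le => i.
apply: le_trans (lerD (coord_dist_le x y i) (coord_dist_le y z i)).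
have min_triangle (a b c u : R) : 0 <= a -> 0 <= b -> 0 <= u -> c <= a + b ->
    Num.min c u <= Num.min a u + Num.min b u.
  move=> *; rewrite !minEle.
  by case: (leP c u); case: (leP a u); case: (leP b u); lra.
apply: min_triangle; rewrite ?mdist_ge0 ?invr_ge0 ?ler0n //.
exact: metric_triangle.
Qed.

HB.instance Definition _ := isMetric.Build R metric_product
  product_distxx product_dist_positivity product_dist_sym product_dist_triangle.

Lemma ball_productE (x y : metric_product) (e : R) :
  ball x e y = (product_dist x y < e) :> Prop.
Proof. by rewrite ballEmdist. Qed.

Lemma ball_product (x y : metric_product) n (e : R) : n.+1%:R^-1 < e ->
  (forall i, (i < n)%N -> mdist (x i) (y i) < e / 2) -> ball x e y.
Proof.
move=> ne h; rewrite ball_productE.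
apply: (@le_lt_trans _ _ (Num.max (e / 2) n.+1%:R^-1)).
  apply: product_dist_le => i; rewrite ge_min !le_max.
  have [/h/ltW ->//|ni] := ltnP i n.
  by rewrite [X in _ || (_ || X)]lef_pV2 ?posrE ?ltr0n// ler_nat ltnS ni !orbT.
have e0 : 0 < e by apply: lt_trans ne; rewrite invr_gt0 ltr0n.
by rewrite gt_max ne andbT ltr_pdivrMr// ltr_pMr// ltr1n.
Qed.

Lemma ball_coord (x y : metric_product) i n (e : R) : (i <= n)%N ->
  e <= n.+1%:R^-1 -> ball x e y -> ball (x i) e (y i).
Proof.
move=> ni en; rewrite ball_productE ballEmdist/= => xy.
have := le_lt_trans (coord_dist_le x y i) xy; rewrite gt_min => /orP[//|ie].
have := lt_le_trans ie en; rewrite ltf_pV2 ?posrE ?ltr0n// ltr_nat; lia.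
Qed.

Lemma natinv_lt (e : R) : 0 < e -> exists n, n.+1%:R^-1 < e.
Proof.
move=> e0; exists (Num.truncn e^-1).
by rewrite -[ltRHS]invrK ltf_pV2 ?posrE ?invr_gt0// truncnS_gt.
Qed.

End ProductMetric.

Lemma continuous_to_prod (X : topologicalType) (Y : nat -> topologicalType)
    (f : X -> prod_topology Y) :
  (forall i, continuous (fun x => f x i)) -> continuous f.
Proof.
move=> cf x; apply/cvg_sup => i U [_ [[W oW <-] Wx WU]].
apply: filterS WU _; apply: (cf i x); exact: open_nbhs_nbhs.
Qed.

Lemma compact_uniform_continuity (R : realType) (U V : metricType R)
    (f : U -> V) :
  compact [set: U] -> continuous f -> forall e, 0 < e ->
  exists2 d, 0 < d & forall x y, ball x d y -> ball (f x) e (f y).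
Proof.
move=> cU cf e e0.
have : \forall d \near 0^'+, [set: U] `<=`
    [set x | forall y, ball x d y -> ball (f x) e (f y)].
  apply: (compact_near_coveringP _).1 => // x _.
  have e20 : 0 < e / 2 by rewrite divr_gt0.
  have /nbhs_ballP[r /= r0 rf] := cf x _ (nbhsx_ballx (f x) _ e20).
  have r20 : 0 < r / 2 by rewrite divr_gt0.
  exists (ball x (r / 2), [set d | d < r / 2]) => /=.
    by split; [exact: nbhsx_ballx|exact: nbhs_right_lt].
  move=> [x' d]/= [xx' dr] y x'y.
  apply: (@ball_splitr _ _ (f x)); apply: rf.
    by apply: le_ball xx'; lra.
  by apply: ball_split xx' _; apply: le_ball x'y; exact: ltW.
move=> H; near (0:R)^'+ => d; exists d; first by near: d; exact: nbhs_right_gt.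
by move=> x y; have /(_ _ x) := near H d; apply.
Unshelve. all: by end_near. Qed.

Section Homeo.
Variables (R : realType) (Y : nat -> topologicalType) (T : nat -> metricType R).
Variables (h : forall i, T i -> Y i) (g : forall i, Y i -> T i).
Hypothesis ch : forall i, continuous (@h i).
Hypothesis cg : forall i, continuous (@g i).
Hypothesis hK : forall i, cancel (@h i) (@g i).
Hypothesis gK : forall i, cancel (@g i) (@h i).

Definition to_prod (x : metric_product T) : prod_topology Y := fun i => h (x i).
Definition of_prod (y : prod_topology Y) : metric_product T := fun i => g (y i).

Lemma to_prod_continuous : continuous to_prod.
Proof.
apply: continuous_to_prod => i x.
apply: (@continuous_comp _ _ _ (fun x : metric_product T => x i)).
  move=> U /nbhs_ballP[e /= e0 eU]; apply/nbhs_ballP.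
  exists (Num.min e i.+1%:R^-1); first by rewrite /= lt_min e0 invr_gt0 ltr0n.
  move=> y xy; apply: eU; apply: (@le_ball _ _ _ (Num.min e i.+1%:R^-1)).
    by rewrite ge_min lexx.
  apply: (@ball_coord _ _ x y i i) => //.
  by rewrite ge_min lexx orbT.
exact: ch.
Qed.

Lemma of_prod_continuous : continuous of_prod.
Proof.
move=> y U /nbhs_ballP[e /= e0 eU].
have [n ne] := natinv_lt e0.
have e20 : 0 < e / 2 by rewrite divr_gt0.
have FF : Filter (nbhs y) by exact: (@nbhs_filter (prod_topology Y) y).
have near_n : forall m, \forall y' \near y, forall i, (i < m)%N ->
    mdist (g (y i)) (g (y' i)) < e / 2.
  elim=> [|m IH]; first by apply: (filterE (F := nbhs y)).
  have nm : \forall y' \near y, ball (g (y m)) (e / 2) (g (y' m)).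
    have := @continuous_comp _ _ _ (fun y : prod_topology Y => y m) (@g m) y
      (@proj_continuous nat Y m y) (@cg m _).
    by apply; exact: nbhsx_ballx.
  apply: filterS2 IH nm => y' IH; rewrite ballEmdist/= => ym i.
  by rewrite ltnS leq_eqVlt => /orP[/eqP ->//|/IH].
apply: filterS (near_n n) => y' hy'; apply: eU.
exact: ball_product ne hy'.
Qed.

Lemma to_prod_homeo : homeomorphism to_prod.
Proof.
split; first exact: to_prod_continuous.
exists of_prod; first exact: of_prod_continuous.
by split=> x; apply: functional_extensionality_dep => i;
  rewrite /of_prod /to_prod ?hK ?gK.
Qed.

End Homeo.

(** * Proof of the theorem *)

Lemma surjective_image_compact (X X' : topologicalType) (f : X -> X') :
  compact [set: X] -> continuous f -> (forall y, exists x, f x = y) ->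
  compact [set: X'].
Proof.
move=> cX cf sf; rewrite (_ : setT = f @` setT).
  by apply: continuous_compact => //; exact: continuous_subspaceT.
by apply/seteqP; split=> // y _; have [x <-] := sf y; exists x.
Qed.

Theorem theorem4 (R : realType) (Y : nat -> topologicalType)
    (continuumY : forall i : nat, continuum R (Y i))
    (span0Y : forall i : nat, span0 R (Y i)) :
  proximate_fpp R (prod_topology Y).
Proof.
have data i : exists (T : metricType R) (hg : (T -> Y i) * (Y i -> T)),
    [/\ continuous hg.1, continuous hg.2, cancel hg.1 hg.2 & cancel hg.2 hg.1].
  have [[_ [T [h [ch [g cg [hK gK]]]]]] _ _] := continuumY i.
  by exists T, (h, g).
pose T i := projT1 (cid (data i)).
have data' i : exists hg : (T i -> Y i) * (Y i -> T i),
    [/\ continuous hg.1, continuous hg.2, cancel hg.1 hg.2 & cancel hg.2 hg.1].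
  exact: (projT2 (cid (data i))).
pose h i := (projT1 (cid (data' i))).1; pose g i := (projT1 (cid (data' i))).2.
have ch i : continuous (h i) by rewrite /h; case: cid => D [].
have cg i : continuous (g i) by rewrite /g; case: cid => D [].
have hK i : cancel (h i) (g i) by rewrite /h /g; case: cid => D [].
have gK i : cancel (g i) (h i) by rewrite /h /g; case: cid => D [].
clearbody h g; clear data'.
have cT i : compact [set: T i].
  have [[cY _] _ _] := continuumY i.
  apply: surjective_image_compact cY (@cg i) _ => x.
  by exists (h i x); exact: hK.
have coT i : connected [set: T i].
  have [_ coY _] := continuumY i.
  rewrite (_ : setT = g i @` setT); first exact: continuous_image_connected.
  by apply/seteqP; split=> // x _; exists (h i x) => //; exact: hK.
have t0 i : T i.
  apply: (g i); apply: projT1; apply: cid (_ : exists y : Y i, True).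
  by have [_ _ [y _]] := continuumY i; exists y.
have gapT n (k : R) : 0 < k -> exists2 d, 0 < d & semispan_gap (T n) k d.
  move=> k0; apply: zero_span_semispan_gap => //.
  apply: (span0_coincidence (h := h n)) => //.
  by split; [exact: ch|exists (g n); [exact: cg|split; [exact: hK|exact: gK]]].
have cP : compact [set: prod_topology Y].
  have := @tychonoff nat Y (fun=> setT).
  rewrite (_ : [set f | _] = setT); last by apply/seteqP; split.
  by apply => i; have [[cY _] _ _] := continuumY i.
have cto := to_prod_continuous ch.
have cto' := of_prod_continuous cg.
pose P := metric_product T.
split.
  by split => //; exists P, (to_prod h); exact: to_prod_homeo ch cg hK gK.
have cPT : compact [set: P].
  apply: surjective_image_compact cP cto' _ => x; exists (to_prod h x).
  by apply: functional_extensionality_dep => i; rewrite /of_prod /to_prod hK.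
move=> M q [cq [r cr [qK rK]]] eps eps0.
pose psi (x : P) : M := r (to_prod h x).
pose phi (a : M) : P := of_prod g (q a).
have cpsi : continuous psi.
  by move=> x; apply: continuous_comp; [exact: cto|exact: cr].
have cphi : continuous phi.
  by move=> x; apply: continuous_comp; [exact: cq|exact: cto'].
have psiK : cancel phi psi.
  move=> a; rewrite /psi /phi (_ : to_prod h _ = q a) ?qK//.
  by apply: functional_extensionality_dep => i; rewrite /of_prod /to_prod gK.
have cM : compact [set: M].
  by apply: surjective_image_compact cPT cpsi _ => a; exists (phi a).
(* The maps [phi] and [psi] are mutually inverse; [f] is transported to the
   metric product as [phi \o f \o psi].  The constants are chosen in the order
   [eps], [k], [n], [d], [delta], and then [eta], [e] once [f] is given. *)
have [k k0 hk] := compact_uniform_continuity cPT cpsi eps0.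
have [n nk] := natinv_lt k0.
have k20 : 0 < k / 2 by rewrite divr_gt0.
have [d d0 hd] := approximate_fixed_point cT coT t0 n (fun i => gapT i _ k20).
have d'0 : 0 < Num.min d n.+1%:R^-1 by rewrite lt_min d0 invr_gt0 ltr0n.
have [delta delta0 hdelta] := compact_uniform_continuity cM cphi d'0.
exists delta => // f [eta eta0 feta].
have [e e0 he] := compact_uniform_continuity cPT cpsi eta0.
have [||x hx] := hd (fun x => phi (f (psi x))) (e / 2).
- by rewrite divr_gt0.
- move=> x y xy i ni; apply: (@le_ball _ _ _ (Num.min d n.+1%:R^-1)).
    by rewrite ge_min lexx.
  apply: (@ball_coord _ _ (phi (f (psi x))) (phi (f (psi y))) i n).
  + exact: ltnW.
  + by rewrite ge_min lexx orbT.
  apply: hdelta; rewrite ballEmdist/=; apply: feta.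
  have [m me] := natinv_lt e0.
  have : ball (psi x) eta (psi y).
    apply: he; apply: ball_product me _ => j _.
    by have := xy j; rewrite ballEmdist.
  by rewrite ballEmdist.
exists (psi x); have := hk x (phi (f (psi x))).
rewrite psiK => /(_ (ball_product nk hx)).
by rewrite ballEmdist => /ltW.
Qed.
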